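(* Let $G$ be a nilpotent group, let $\phi$ be an endomorphism of $G$, and let $H$ be a normal subgroup of $G$ with $\phi(H)\subseteq H$. Then $$h(\phi)=h(\phi\upharpoonright_H)+h(\bar\phi_{G/H}),$$ where $\phi\upharpoonright_H$ is the restriction of $\phi$ to $H$ and $\bar\phi_{G/H}$ is the endomorphism of $G/H$ induced by $\phi$.
   Context: Algebraic entropy: for a group $G$, an endomorphism $\phi$ of $G$ and a non-empty finite subset $F\subseteq G$, put $T_n(\phi,F)=F\,\phi(F)\cdots\phi^{n-1}(F)$ (product of subsets) for each integer $n\ge 1$, and $H(\phi,F)=\limsup_{n\to\infty}\frac1n\log|T_n(\phi,F)|$ (in fact a limit). The algebraic entropy of $\phi$ is $h(\phi)=\sup_F H(\phi,F)\in[0,\infty]$, where $F$ ranges over all non-empty finite subsets of $G$. Sums are taken in $[0,\infty]$ with the usual convention $x+\infty=\infty$. *)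

(* Defs.v *)
From HB Require Import structures.
From mathcomp Require Import all_boot all_order all_algebra.
From mathcomp Require Import finmap.
From mathcomp Require Import all_classical all_reals all_analysis.

Set Implicit Arguments.
Unset Strict Implicit.
Unset Printing Implicit Defensive.

Local Open Scope classical_set_scope.
Local Open Scope quotient_scope.
Local Open Scope group_scope.

(* Z_0 = 1, and Z_(n+1) / Z_n = Z(G / Z_n). *)
Fixpoint upper_central (G : groupType) (n : nat) : set G :=
  if n is m.+1 then [set x | forall y : G, upper_central m [~ x, y]]
  else [set 1].

Definition nilpotent_group (G : groupType) : Prop :=
  exists n : nat, upper_central n = [set: G].

HB.mixin Record isConjClosed (G : groupType) (S : {pred G}) := {
  gpredJr : forall x y : G, x \in S -> x ^ y \in S
}.

#[short(type="normalClosed")]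
HB.structure Definition NormalClosed (G : groupType) :=
  {S of GroupClosed G S & isConjClosed G S}.

Section SubgroupType.
Variables (G : groupType) (H : groupClosed G).

Definition subgroup : Type := {x : G | x \in H}.

HB.instance Definition _ := SubChoice.on subgroup.

Lemma subgroup_closed : group_closed H.
Proof. by split; [exact: gpred1 | exact: gpredF]. Qed.

HB.instance Definition _ :=
  SubChoice_isSubGroup.Build G (H : {pred G}) subgroup subgroup_closed.

End SubgroupType.

Section QuotientGroup.
Variables (G : groupType) (H : normalClosed G).
Implicit Types x y : G.

Definition coset_eq : rel G := fun x y => x^-1 * y \in H.

Lemma coset_eq_refl : reflexive coset_eq.
Proof. by move=> x; rewrite /coset_eq mulVg gpred1. Qed.

Lemma coset_eq_sym : symmetric coset_eq.
Proof. by move=> x y; rewrite /coset_eq -gpredV invgM invgK. Qed.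

Lemma coset_eq_trans : transitive coset_eq.
Proof.
move=> y x z xy yz; rewrite /coset_eq.
by rewrite -(mulgK y x^-1) -mulgA gpredM.
Qed.

Definition coset_equiv : equiv_rel G :=
  EquivRel coset_eq coset_eq_refl coset_eq_sym coset_eq_trans.

Definition quotient_group : Type := {eq_quot coset_equiv}.

HB.instance Definition _ := Choice.on quotient_group.
HB.instance Definition _ := EqQuotient.on quotient_group.

Lemma coset_eqP x y :
  reflect (\pi_quotient_group x = \pi_quotient_group y) (x^-1 * y \in H).
Proof. by rewrite -[_ \in H]/(coset_equiv x y); apply: eqquotP. Qed.

Lemma quotient_groupW (P : quotient_group -> Prop) :
  (forall x, P (\pi_quotient_group x)) -> forall a, P a.
Proof. by move=> Ppi a; rewrite -[a]reprK. Qed.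

Definition quot_one : quotient_group := \pi_quotient_group 1.
Definition quot_mul (a b : quotient_group) : quotient_group :=
  \pi_quotient_group (repr a * repr b).
Definition quot_inv (a : quotient_group) : quotient_group :=
  \pi_quotient_group (repr a)^-1.

Lemma quot_mulE x y : quot_mul (\pi_quotient_group x) (\pi_quotient_group y) =
  \pi_quotient_group (x * y).
Proof.
apply/esym/coset_eqP.
have /coset_eqP Hx := esym (reprK (\pi_quotient_group x)).
have /coset_eqP Hy := esym (reprK (\pi_quotient_group y)).
set x' := repr _ in Hx *; set y' := repr _ in Hy *.
have -> : (x * y)^-1 * (x' * y') = (x^-1 * x') ^ y * (y^-1 * y').
  by rewrite /conjg invgM !mulgA mulgK.
by rewrite gpredM // gpredJr.
Qed.

Lemma quot_invE x : quot_inv (\pi_quotient_group x) = \pi_quotient_group x^-1.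
Proof.
apply/esym/coset_eqP; rewrite invgK.
have /coset_eqP Hx := esym (reprK (\pi_quotient_group x)).
set x' := repr _ in Hx *.
have -> : x * x'^-1 = (x^-1 * x')^-1 ^ x^-1.
  by rewrite /conjg !invgM !invgK !mulgA mulgK.
by rewrite gpredJr // gpredV.
Qed.

Lemma quot_mulA : associative quot_mul.
Proof.
by elim/quotient_groupW=> x; elim/quotient_groupW=> y; elim/quotient_groupW=> z; rewrite !quot_mulE mulgA.
Qed.

Lemma quot_mul1 : left_id quot_one quot_mul.
Proof. by elim/quotient_groupW=> x; rewrite quot_mulE mul1g. Qed.

Lemma quot_mulr1 : right_id quot_one quot_mul.
Proof. by elim/quotient_groupW=> x; rewrite quot_mulE mulg1. Qed.

Lemma quot_mulV : left_inverse quot_one quot_inv quot_mul.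
Proof. by elim/quotient_groupW=> x; rewrite quot_invE quot_mulE mulVg. Qed.

Lemma quot_mulrV : right_inverse quot_one quot_inv quot_mul.
Proof. by elim/quotient_groupW=> x; rewrite quot_invE quot_mulE mulgV. Qed.

HB.instance Definition _ := isGroup.Build quotient_group
  quot_mulA quot_mul1 quot_mulr1 quot_mulV quot_mulrV.

Lemma quot_piM x y : \pi_quotient_group (x * y) =
  \pi_quotient_group x * \pi_quotient_group y.
Proof. by rewrite -quot_mulE. Qed.

End QuotientGroup.

Lemma mult1 (G K : groupType) (f : {multiplicative G -> K}) : f 1 = 1.
Proof. by apply: (mulgI (f 1)); rewrite -gmulfM !mulg1. Qed.

Section Restriction.
Variables (G : groupType) (phi : {multiplicative G -> G}) (H : groupClosed G).
Hypothesis phiH : {homo phi : x / x \in H}.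

Definition restr_endo (u : subgroup H) : subgroup H :=
  Sub (phi (val u)) (phiH (valP u)).

Lemma restr_endoM : {morph restr_endo : u v / u * v}.
Proof. by move=> u v; apply: val_inj; exact: gmulfM. Qed.

HB.instance Definition _ :=
  isMultiplicative.Build (subgroup H) (subgroup H) restr_endo restr_endoM.

End Restriction.

Section InducedOnQuotient.
Variables (G : groupType) (phi : {multiplicative G -> G}) (H : normalClosed G).
Hypothesis phiH : {homo phi : x / x \in H}.

(* [phiH] is what makes the value independent of the representative, see
   [quot_endoE]. *)
Definition quot_endo of {homo phi : x / x \in H} :=
  fun a : quotient_group H => \pi_(quotient_group H) (phi (repr a)).

Lemma quot_endoE x : quot_endo phiH (\pi_(quotient_group H) x) =
  \pi_(quotient_group H) (phi x).
Proof.
apply/esym/coset_eqP.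
have /coset_eqP Hx := esym (reprK (\pi_(quotient_group H) x)).
have /phiH := Hx; rewrite gmulfM; set z := phi x^-1.
suff -> : z = (phi x)^-1 by [].
by apply: (mulIg (phi x)); rewrite mulVg -gmulfM mulVg mult1.
Qed.

Lemma quot_endoM : {morph quot_endo phiH : a b / a * b}.
Proof.
elim/quotient_groupW=> x; elim/quotient_groupW=> y.
by rewrite -quot_piM !quot_endoE gmulfM quot_piM.
Qed.

HB.instance Definition _ := isMultiplicative.Build
  (quotient_group H) (quotient_group H) (quot_endo phiH) quot_endoM.

End InducedOnQuotient.

Section Entropy.
Variables (R : realType) (G : groupType) (phi : {multiplicative G -> G}).
Local Open Scope fset_scope.

Definition fset_mulg (A B : {fset G}) : {fset G} :=
  [fset (x * y)%g | x in A, y in B].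

(* T_n(phi, F) = F phi(F) ... phi^(n-1)(F); T_0 is the singleton of 1. *)
Definition trajectory (F : {fset G}) (n : nat) : {fset G} :=
  \big[fset_mulg/[fset 1%g]]_(i < n) [fset iter i phi x | x in F].

Definition entropy_at (F : {fset G}) : \bar R :=
  limn_esup (fun n : nat => (ln (#|` trajectory F n|%:R : R) / n%:R)%R%:E).

Definition algebraic_entropy : \bar R :=
  ereal_sup [set entropy_at F | F in [set F | F != fset0]]%classic.

End Entropy.

(* Main.v *)
Require Import Defs.
From HB Require Import structures.
From mathcomp Require Import all_boot all_order all_algebra.
From mathcomp Require Import finmap.
From mathcomp Require Import all_classical all_reals all_analysis.
From mathcomp Require Import ring.

(** For a [phi]-invariant normal subgroup [L] of [G] and a [phi]-invariant [K]
    containing it, let [sec_entropy K L] be the entropy of the endomorphism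
    that [phi] induces on [K / L], computed inside [G] by counting the
    [L]-cosets met by the trajectories of the finite subsets of [K]. Working
    in [G] makes the sections [K / L] of different kinds (subgroups,
    quotients, quotients of subgroups) comparable without any isomorphism
    theorem.

    The core is additivity along a central extension ([sec_entropyD]): if
    [L <= M <= K] and [[M, G] <= L], then
    [sec_entropy K L = sec_entropy K M + sec_entropy M L]. Modulo [L] the
    elements of [M] commute with everything, so trajectories of products can
    be rearranged.
    - For the lower bound, take [E] in [M] and [F] in [K]. Modulo [L],
      [T_n(EF)] contains [T_n(E) T_n(F)], which meets at least as many
      [L]-cosets as the number of [L]-cosets of [T_n(E)] times the number of
      [M]-cosets of [T_n(F)].
    - For the upper bound, fix [k] and let [S] represent the [M]-cosets of
      [T_k(F)], so that [T_k(F)] lies in [S E] for some finite [E] in [M].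
      Since [T_(nk)(F)] is the trajectory of length [n] of [T_k(F)] under
      [phi^k], it lies modulo [L] in the product of a set of at most [|S|^n]
      elements with [T_(nk)(E)]. Letting [n] and then [k] grow, the rate of
      [F] modulo [L] is at most its rate modulo [M] plus the entropy of
      [M / L].
    The growth sequences are subadditive, so by Fekete's lemma their limsup is
    an infimum; each bound then becomes a statement about single terms.

    Nilpotency provides the central steps. Put [N_0 = H] and
    [N_(i+1) = [N_i, G]]. These subgroups are normal, [phi]-invariant (unlike
    the terms of the upper central series) and reach the trivial group. Both
    [G / N_(i+1)] over [G / N_i] and [H / N_(i+1)] over [H / N_i] have the
    same central kernel [N_i / N_(i+1)], hence an induction on [i] gives
    [sec_entropy G N_i = sec_entropy G H + sec_entropy H N_i]: both sides grow
    by [sec_entropy N_i N_(i+1)] at each step. *)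

Set Implicit Arguments.
Unset Strict Implicit.
Unset Printing Implicit Defensive.

Import Order.TTheory GRing.Theory Num.Theory.
Import numFieldNormedType.Exports.
Local Open Scope classical_set_scope.
Local Open Scope group_scope.

(** * Products of finite sets and trajectories *)

Section Trajectories.
Variables (G : groupType) (phi : {multiplicative G -> G}).
Implicit Types (A B F : {fset G}) (x y z : G).

Lemma mem_mulg A B x : reflect (exists y z, [/\ y \in A, z \in B & x = y * z])
  (x \in fset_mulg A B).
Proof.
apply: (iffP idP) => [/imfset2P[y yA [z zB ->]]|[y [z [yA zB ->]]]].
  by exists y, z.
by apply/imfset2P; exists y => //; exists z.
Qed.

Lemma fset_mulgA : associative (@fset_mulg G).
Proof.
move=> A B C; apply/fsetP => x; apply/mem_mulg/mem_mulg.
  case=> a [_ [aA /mem_mulg [b [c [bB cC ->]]] ->]].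
  by exists (a * b), c; rewrite mulgA; split=> //; apply/mem_mulg; exists a, b.
case=> _ [c [/mem_mulg [a [b [aA bB ->]]] cC ->]].
by exists a, (b * c); rewrite mulgA; split=> //; apply/mem_mulg; exists b, c.
Qed.

Lemma fset_mul1g : left_id [fset (1 : G)]%fset (@fset_mulg G).
Proof.
move=> A; apply/fsetP => x; apply/mem_mulg/idP.
  by case=> _ [z [/fset1P -> zA ->]]; rewrite mul1g.
by move=> xA; exists 1, x; rewrite mul1g fset11.
Qed.

Lemma fset_mulg1 : right_id [fset (1 : G)]%fset (@fset_mulg G).
Proof.
move=> A; apply/fsetP => x; apply/mem_mulg/idP.
  by case=> z [_ [zA /fset1P -> ->]]; rewrite mulg1.
by move=> xA; exists x, 1; rewrite mulg1 fset11.
Qed.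

(* The big operator lemmas that peel off the last factor of a trajectory rely
   on this structure. *)
HB.instance Definition _ := Monoid.isLaw.Build {fset G} [fset (1 : G)]%fset
  (@fset_mulg G) fset_mulgA fset_mul1g fset_mulg1.

Lemma trajectory0 F : trajectory phi F 0 = [fset 1]%fset.
Proof. by rewrite /trajectory big_ord0. Qed.

Lemma trajectoryS F n : trajectory phi F n.+1 =
  fset_mulg (trajectory phi F n) [fset iter n phi x | x in F]%fset.
Proof. by rewrite /trajectory big_ord_recr. Qed.

Lemma mem_trajectoryS F n x :
  reflect (exists y z, [/\ y \in trajectory phi F n, z \in F &
                           x = y * iter n phi z])
    (x \in trajectory phi F n.+1).
Proof.
rewrite trajectoryS; apply: (iffP (mem_mulg _ _ _)).
  by case=> y [_ [yT /imfsetP[z zF ->] ->]]; exists y, z.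
case=> y [z [yT zF ->]]; exists y, (iter n phi z); split=> //.
exact: in_imfset.
Qed.

Lemma iter_phi1 n : iter n phi 1 = 1.
Proof. by elim: n => //= n ->; rewrite mult1. Qed.

Lemma iter_phiM n x y : iter n phi (x * y) = iter n phi x * iter n phi y.
Proof. by elim: n => //= n ->; rewrite gmulfM. Qed.

(** The source of the submultiplicativity of growth. *)
Lemma mem_trajectoryD F n m x :
  x \in trajectory phi F (n + m) ->
  exists y z, [/\ y \in trajectory phi F n, z \in trajectory phi F m &
                  x = y * iter n phi z].
Proof.
elim: m x => [|m IH] x.
  rewrite addn0 => xT; exists x, 1.
  by rewrite trajectory0 fset11 iter_phi1 mulg1.
rewrite addnS => /mem_trajectoryS[_ [w [/IH[y [z [yT zT ->]]] wF ->]]].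
exists y, (z * iter m phi w); rewrite iter_phiM -iterD mulgA; split=> //.
by apply/mem_trajectoryS; exists z, w.
Qed.

Lemma fset1g_neq0 : [fset (1 : G)]%fset != fset0.
Proof. by apply/fset0Pn; exists 1; rewrite fset11. Qed.

End Trajectories.

Lemma card_fsetM (T U : choiceType) (A : {fset T}) (B : {fset U}) :
  #|` (A `*` B)%fset| = (#|` A| * #|` B|)%N.
Proof.
have -> : (A `*` B)%fset = [fset p in [seq (x, y) | x <- A, y <- B]]%fset.
  apply/fsetP => -[x y]; rewrite in_fsetM !inE /=.
  apply/andP/allpairsP => [[xA yB]|[[a b] [/= aA bB [-> ->]]]] //.
  by exists (x, y).
rewrite card_imfset //= undup_id ?size_allpairs //.
by apply: allpairs_uniq => [||[a b] [c d] _ _ [-> ->]] //; exact: fset_uniq.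
Qed.

(** * Counting cosets *)

Section Cosets.
Variables (G : groupType) (phi : {multiplicative G -> G}).
Implicit Types (A B E F S : {fset G}) (K L M : set G) (x y z : G).

Record invariant_normal L : Prop := InvariantNormal {
  inv_normal1 : L 1;
  inv_normalM : forall x y, L x -> L y -> L (x * y);
  inv_normalV : forall x, L x -> L x^-1;
  inv_normalJ : forall x y, L x -> L (x ^ y);
  inv_normal_phi : forall x, L x -> L (phi x)
}.

(** Cosets are compared as sets, so that congruence modulo [L] is an equation
    that can be rewritten with. *)
Definition lcoset L x : set G := [set y | L (x^-1 * y)].

Definition ncosets L A : nat := #|` [fset lcoset L x | x in A]%fset|.

Lemma lcosetP L x y : invariant_normal L ->
  lcoset L x = lcoset L y <-> L (x^-1 * y).
Proof.
move=> nL; split=> [e|Lxy].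
  have : lcoset L y y by rewrite /lcoset /= mulVg; exact: inv_normal1 nL.
  by rewrite -e.
have trans u v w : L (u^-1 * v) -> L (v^-1 * w) -> L (u^-1 * w).
  move=> Luv Lvw; rewrite -[w](mulVKg v) mulgA.
  exact: (inv_normalM nL).
apply/seteqP; split=> z; rewrite /lcoset /=; last exact: (trans x y).
apply: (trans y x); rewrite -[y^-1 * x]invgK invgM invgK.
exact: (inv_normalV nL).
Qed.

Lemma lcosetM L x x' y y' : invariant_normal L ->
  lcoset L x = lcoset L x' -> lcoset L y = lcoset L y' ->
  lcoset L (x * y) = lcoset L (x' * y').
Proof.
move=> nL /(lcosetP _ _ nL) Lx /(lcosetP _ _ nL) Ly; apply/(lcosetP _ _ nL).
have -> : (x * y)^-1 * (x' * y') = (x^-1 * x') ^ y * (y^-1 * y').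
  by rewrite /conjg invgM !mulgA mulgK.
by apply: (inv_normalM nL) => //; exact: (inv_normalJ nL).
Qed.

Lemma inv_normal_iter L n x : invariant_normal L -> L x -> L (iter n phi x).
Proof. by move=> nL Lx; elim: n => //= n; exact: (inv_normal_phi nL). Qed.

Lemma lcoset_iter L n x y : invariant_normal L ->
  lcoset L x = lcoset L y -> lcoset L (iter n phi x) = lcoset L (iter n phi y).
Proof.
move=> nL /(lcosetP _ _ nL) Lxy; apply/(lcosetP _ _ nL).
suff <- : iter n phi (x^-1 * y) = (iter n phi x)^-1 * iter n phi y.
  exact: inv_normal_iter.
by apply: (mulgI (iter n phi x)); rewrite -iter_phiM !mulVKg.
Qed.

Lemma ncosets_le L A B :
  (forall x, x \in A -> exists2 y, y \in B & lcoset L x = lcoset L y) ->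
  (ncosets L A <= ncosets L B)%N.
Proof.
move=> AB; apply/fsubset_leq_card/fsubsetP => _ /imfsetP[x /AB[y yB ->] ->].
exact: in_imfset.
Qed.

Lemma ncosets_le_card L A : (ncosets L A <= #|` A|)%N.
Proof. exact: leq_imfset_card. Qed.

Lemma ncosets_gt0 L A : A != fset0 -> (0 < ncosets L A)%N.
Proof.
case/fset0Pn => x xA; rewrite cardfs_gt0; apply/fset0Pn.
by exists (lcoset L x); exact: in_imfset.
Qed.

(** Replaces the count of cosets by the cardinal of an honest set of
    representatives, for which products and injectivity are available. *)
Lemma coset_reps L A : exists S : {fset G},
  [/\ {subset S <= A}, #|` S| = ncosets L A,
      {in S &, injective (lcoset L)} &
      forall x, x \in A -> exists2 s, s \in S & lcoset L x = lcoset L s].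
Proof.
have /choice[f fP] (c : set G) : exists s : G,
    c \in [fset lcoset L x | x in A]%fset -> s \in A /\ lcoset L s = c.
  have [/imfsetP[x xA ->]|_] := boolP (c \in _); first by exists x.
  by exists 1.
exists [fset f c | c in [fset lcoset L x | x in A]]%fset.
have fA x : x \in A ->
    f (lcoset L x) \in A /\ lcoset L (f (lcoset L x)) = lcoset L x.
  by move=> xA; apply: fP; exact: in_imfset.
split.
- by move=> _ /imfsetP[_ /imfsetP[x /fA[? _] ->] ->].
- apply: card_in_imfset => s t /imfsetP[x /fA[_ ex] ->].
  move=> /imfsetP[y /fA[_ ey] ->] /= e.
  by rewrite -ex e ey.
- move=> s t /imfsetP[_ /imfsetP[x /fA[_ ex] ->] ->].
  by move=> /imfsetP[_ /imfsetP[y /fA[_ ey] ->] ->]; rewrite ex ey => ->.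
- move=> x xA; exists (f (lcoset L x)); last by case: (fA x xA).
  by apply/in_imfset/in_imfset.
Qed.

Lemma card_fset_mulg A B : (#|` fset_mulg A B| <= #|` A| * #|` B|)%N.
Proof.
rewrite -card_fsetM.
have -> : fset_mulg A B = [fset p.1 * p.2 | p in A `*` B]%fset.
  apply/fsetP => x; apply/mem_mulg/imfsetP.
    by case=> y [z [yA zB ->]]; exists (y, z) => //=; rewrite in_fsetM yA.
  by case=> -[y z] /=; rewrite in_fsetM => /andP[yA zB] ->; exists y, z.
exact: leq_imfset_card.
Qed.

Lemma ncosetsM_le L A B : invariant_normal L ->
  (ncosets L (fset_mulg A B) <= ncosets L A * ncosets L B)%N.
Proof.
move=> nL; have [S [_ <- _ SA]] := coset_reps L A.
have [S' [_ <- _ SB]] := coset_reps L B.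
apply: leq_trans (card_fset_mulg S S').
apply: leq_trans (ncosets_le_card L _); apply: ncosets_le => x.
case/mem_mulg=> a [b [/SA[s sS es] /SB[s' sS' es'] ->]].
by exists (s * s'); [apply/mem_mulg; exists s, s' | exact: lcosetM].
Qed.

(** From the product [s s'] of representatives modulo [L] in [M] and modulo [M]
    the factors can be recovered: modulo [M] only [s'] is left, and then
    [s'] cancels on the right. *)
Lemma ncosetsM_ge L M A B :
  invariant_normal L -> invariant_normal M -> L `<=` M ->
  (forall x, x \in A -> M x) ->
  (ncosets L A * ncosets M B <= ncosets L (fset_mulg A B))%N.
Proof.
move=> nL nM LM AM; have [S [SA <- injS _]] := coset_reps L A.
have [S' [SB <- injS' _]] := coset_reps M B.
rewrite -card_fsetM.
pose f (p : G * G) := lcoset L (p.1 * p.2).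
suff injf : {in (S `*` S')%fset &, injective f}.
  rewrite -(card_in_imfset imfset_key injf).
  apply/fsubset_leq_card/fsubsetP => _ /imfsetP[[s s'] /= + ->].
  rewrite in_fsetM => /andP[/SA sA /SB sB]; apply: in_imfset.
  by apply/mem_mulg; exists s, s'.
move=> [s s'] [t t'] /=; rewrite !in_fsetM /= => /andP[sS sS'] /andP[tS tS'] e.
have es' : s' = t'.
  apply: injS' => //; apply/(lcosetP _ _ nM).
  have Mst : M ((t^-1 * s) ^ s').
    apply: (inv_normalJ nM); apply: (inv_normalM nM); last exact/AM/SA.
    by apply: (inv_normalV nM); exact/AM/SA.
  have /LM := (lcosetP _ _ nL).1 e => /(inv_normalM nM Mst); congr M.
  by rewrite /conjg invgM -!mulgA !(mulKg, mulVKg).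
congr pair => //; apply: injS => //.
have := lcosetM nL e (erefl (lcoset L t'^-1)).
by rewrite -es' !mulgK.
Qed.

End Cosets.

(** * Growth of trajectories modulo a subgroup *)

Section Growth.
Variables (G : groupType) (phi : {multiplicative G -> G}).
Implicit Types (A B E F S : {fset G}) (K L M : set G) (x y z : G).

Local Notation T := (trajectory phi).
Local Notation invariant_normal := (invariant_normal phi).

Definition growth L F n := ncosets L (T F n).

Lemma trajectory_neq0 F n : F != fset0 -> T F n != fset0.
Proof.
case/fset0Pn => z zF; elim: n => [|n /fset0Pn[y yT]]; apply/fset0Pn.
  by exists 1; rewrite trajectory0 fset11.
by exists (y * iter n phi z); apply/mem_trajectoryS; exists y, z.
Qed.

Lemma growth_gt0 L F n : F != fset0 -> (0 < growth L F n)%N.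
Proof. by move=> F0; exact/ncosets_gt0/trajectory_neq0. Qed.

Lemma mem_trajectory_normal L F n x : invariant_normal L ->
  (forall z, z \in F -> L z) -> x \in T F n -> L x.
Proof.
move=> nL FL; elim: n x => [|n IH] x.
  by rewrite trajectory0 => /fset1P ->; exact: inv_normal1 nL.
case/mem_trajectoryS => y [z [/IH Ly /FL Lz ->]].
by apply: (inv_normalM nL) => //; exact: inv_normal_iter.
Qed.

Lemma ncosets_iter L A n : invariant_normal L ->
  (ncosets L [fset iter n phi x | x in A]%fset <= ncosets L A)%N.
Proof.
move=> nL; have [S [_ <- _ SA]] := coset_reps L A.
apply: (@leq_trans #|` [fset iter n phi x | x in S]%fset|); last first.
  exact: leq_imfset_card.
apply: leq_trans (ncosets_le_card L _); apply: ncosets_le.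
move=> _ /imfsetP[x /SA[s sS exs] ->].
exists (iter n phi s); first exact: in_imfset.
exact: lcoset_iter nL exs.
Qed.

Lemma growthD L F n m : invariant_normal L ->
  (growth L F (n + m) <= growth L F n * growth L F m)%N.
Proof.
move=> nL; apply: leq_trans (leq_mul (leqnn _) (ncosets_iter (T F m) n nL)).
apply: leq_trans (ncosetsM_le _ _ nL); apply: ncosets_le => x.
case/mem_trajectoryD => y [z [yT zT ->]].
exists (y * iter n phi z) => //; apply/mem_mulg.
by exists y, (iter n phi z); split=> //; exact: in_imfset.
Qed.

Lemma trajectory_mono E n m : 1 \in E -> (n <= m)%N -> {subset T E n <= T E m}.
Proof.
move=> E1 /subnKC <-; elim: (m - n)%N => [|k IH] x xT; first by rewrite addn0.
rewrite addnS; apply/mem_trajectoryS; exists x, 1.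
by rewrite iter_phi1 mulg1; split=> //; exact: IH.
Qed.

Section CentralExtension.
Variables L M : set G.
Hypotheses (nL : invariant_normal L) (nM : invariant_normal M).
Hypothesis LM : L `<=` M.
Hypothesis cMG : forall x y, M x -> L [~ x, y].

Lemma lcoset_central x y : M x -> lcoset L (x * y) = lcoset L (y * x).
Proof.
move=> Mx; apply/esym/(lcosetP _ _ nL); have := cMG y Mx; congr L.
by rewrite commgEl /conjg invgM !mulgA.
Qed.

(** Modulo [L], the factors coming from [E] move to the left past those coming
    from [F], so that [T_n(E) T_n(F)] and [T_n(E F)] are comparable factor by factor. *)
Lemma growth_ge E F n : (forall x, x \in E -> M x) ->
  (growth L E n * growth M F n <= growth L (fset_mulg E F) n)%N.
Proof.
move=> EM.
apply: leq_trans (ncosetsM_ge _ nL nM LM _) _.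
  by move=> x; exact: mem_trajectory_normal.
apply: ncosets_le => _ /mem_mulg[e [f [eT fT ->]]].
elim: n e f eT fT => [|n IH] e f.
  rewrite !trajectory0 => /fset1P -> /fset1P ->.
  by exists 1; rewrite ?mulg1 ?fset11.
case/mem_trajectoryS=> e' [e0 [e'T e0E ->]].
case/mem_trajectoryS=> f' [f0 [f'T f0F ->]].
have [x xT ex] := IH _ _ e'T f'T.
exists (x * iter n phi (e0 * f0)).
  apply/mem_trajectoryS; exists x, (e0 * f0); split=> //.
  by apply/mem_mulg; exists e0, f0.
rewrite iter_phiM -(lcosetM nL ex (erefl _)) -!mulgA.
apply: (lcosetM nL) => //; rewrite !mulgA.
apply: (lcosetM nL) => //; apply: lcoset_central.
by apply: inv_normal_iter => //; exact: EM.
Qed.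

(** Split each element of [T_k(F)] into a representative of its [M]-coset and
    a remainder in [M]; the remainders form [E]. In a product of [n] iterated
    such elements, the remainders move to the right modulo [L] and make up an
    element of the trajectory of [E], because [E] contains 1 and the missing
    times can be filled in. *)
Lemma growth_le F k : (0 < k)%N -> F != fset0 -> exists E,
  [/\ E != fset0, forall x, x \in E -> M x & forall n,
    (growth L F (n * k) <= growth M F k ^ n * growth L E (n * k))%N].
Proof.
move=> k0 F0.
have [S [ST cardS _ TS]] := coset_reps M (T F k).
rewrite -[growth M F k]cardS.
pose E :=
  [fset z in [fset s^-1 * a | s in S, a in T F k] | `[< M z >]]%fset.
have EP s a : s \in S -> a \in T F k -> M (s^-1 * a) -> s^-1 * a \in E.
  move=> sS aT Msa; rewrite !inE; apply/andP.
  by split; [exact: in_imfset2 | exact/asboolP].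
have EM x : x \in E -> M x by rewrite !inE => /andP[_ /asboolP].
have E1 : 1 \in E.
  have /fset0Pn[a /[dup] aT /TS[s sS _]] := trajectory_neq0 k F0.
  rewrite -(mulVg s); apply: EP (ST _ sS) _; rewrite // mulVg.
  exact: inv_normal1 nM.
exists E; split=> // [|n]; first by apply/fset0Pn; exists 1.
(* [P] is the trajectory of length [n] of [S] under the [k]-th iterate. *)
suff [P cardP PT] : exists2 P : {fset G}, (#|` P| <= #|` S| ^ n)%N &
    forall x, x \in T F (n * k) -> exists p e,
      [/\ p \in P, e \in T E (n * k) & lcoset L x = lcoset L (p * e)].
  apply: leq_trans (leq_mul cardP (leqnn _)).
  apply: leq_trans (leq_mul (ncosets_le_card L P) (leqnn _)).
  apply: leq_trans (ncosetsM_le _ _ nL); apply: ncosets_le.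
  move=> x /PT[p [e [pP eT ->]]]; exists (p * e) => //.
  by apply/mem_mulg; exists p, e.
elim: n => [|n [P cardP PT]].
  exists [fset 1]%fset => [|x]; first by rewrite cardfs1.
  rewrite mul0n !trajectory0 => /fset1P ->; exists 1, 1.
  by rewrite !fset11 mulg1.
exists (fset_mulg P [fset iter (n * k) phi s | s in S]%fset).
  apply: leq_trans (card_fset_mulg _ _) _; rewrite expnSr leq_mul //.
  exact: leq_imfset_card.
move=> x; rewrite mulSn addnC => /mem_trajectoryD[y [a [yT aT ->]]].
have [p [e [pP eT eype]]] := PT _ yT.
have [s sS /esym/(lcosetP _ _ nM) Msa] := TS _ aT.
exists (p * iter (n * k) phi s), (e * iter (n * k) phi (s^-1 * a)); split.
- apply/mem_mulg; exists p, (iter (n * k) phi s); split=> //.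
  exact: in_imfset.
- (* The whole remainder of the [n]-th block sits at its first time [n * k]. *)
  apply: (@trajectory_mono _ (n * k).+1) => //.
    by rewrite -addn1 leq_add2l.
  by apply/mem_trajectoryS; exists e, (s^-1 * a); split=> //; exact: EP.
have -> : a = s * (s^-1 * a) by rewrite mulVKg.
rewrite mulKg iter_phiM (lcosetM nL eype (erefl _)) -!mulgA.
apply: (lcosetM nL) => //; rewrite !mulgA; apply: (lcosetM nL) => //.
by apply: lcoset_central; apply: mem_trajectory_normal EM eT.
Qed.

End CentralExtension.

End Growth.

(** * Subadditive sequences *)

Section Fekete.
Variables (R : realType) (a : nat -> R).
Local Open Scope ring_scope.

Definition rate : R := inf [set a n / n%:R | n in [set n : nat | (0 < n)%N]].

Hypothesis a_ge0 : forall n, 0 <= a n.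

Let rates_inf :
  has_inf [set a n / n%:R | n in [set n : nat | (0 < n)%N]].
Proof.
split; first by exists (a 1 / 1%:R), 1%N.
by exists 0 => _ [n _ <-]; rewrite divr_ge0.
Qed.

Lemma rate_le n : (0 < n)%N -> rate <= a n / n%:R.
Proof. by move=> n0; apply: (ge_inf (proj2 rates_inf)); exists n. Qed.

Lemma rate_ge (x : R) : (forall n, (0 < n)%N -> x <= a n / n%:R) -> x <= rate.
Proof.
move=> xa; apply: lb_le_inf; first exact: proj1 rates_inf.
by move=> _ [n n0 <-]; exact: xa.
Qed.

Lemma rate_adherent (e : R) : 0 < e ->
  exists2 n, (0 < n)%N & a n / n%:R < rate + e.
Proof. by move=> /inf_adherent/(_ rates_inf)[_ [n n0 <-] ?]; exists n. Qed.

Hypothesis a_subadditive : forall n m, a (n + m) <= a n + a m.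

Lemma subadditive_mulD q k r : a (q * k + r) <= q%:R * a k + a r.
Proof.
elim: q => [|q IH]; first by rewrite mul0r add0r.
rewrite mulSn -addnA -natr1 mulrDl mul1r [leRHS]addrAC [leRHS]addrC.
by apply: le_trans (a_subadditive _ _) _; rewrite lerD2l.
Qed.

Lemma subadditive_mul q k : (0 < q)%N -> a (q * k) <= q%:R * a k.
Proof.
case: q => // q _; rewrite mulSnr; apply: le_trans (subadditive_mulD _ _ _) _.
by rewrite -[in leRHS]natr1 mulrDl mul1r.
Qed.

(** Fekete's lemma: writing [n = q k + r] with [r < k], the average at [n] is
    at most the average at [k] plus a bounded quantity divided by [n]. *)
Lemma fekete : a n / n%:R @[n --> \oo] --> rate.
Proof.
apply/cvgrPdist_le => e e0.
have [k k0 ak] := rate_adherent (divr_gt0 e0 (ltr0n _ 2)).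
pose B := \sum_(i < k) a i.
have aB r : (r < k)%N -> a r <= B.
  move=> rk; rewrite /B (bigD1 (Ordinal rk)) //= lerDl.
  exact: sumr_ge0.
near=> n.
have n0 : (0 < n)%N by near: n; exact: nbhs_infty_gt.
have nR : 0 < n%:R :> R by rewrite ltr0n.
rewrite distrC ger0_norm; last by rewrite subr_ge0 rate_le.
rewrite lerBlDl; apply: (@le_trans _ _ (a k / k%:R + B / n%:R)); last first.
  have Bn : B / n%:R <= e / 2.
    rewrite ler_pdivrMr // mulrC -ler_pdivrMr ?divr_gt0 //.
    by near: n; exact: nbhs_infty_ger.
  rewrite [leRHS](_ : _ = rate + e / 2 + e / 2); last by rewrite -addrA -splitr.
  by apply: lerD => //; exact: ltW.
rewrite ler_pdivrMr // mulrDl divfK ?gt_eqF //.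
rewrite [X in a X](divn_eq n k).
apply: le_trans (subadditive_mulD _ _ _) _; apply: lerD; last first.
  by apply: aB; rewrite ltn_mod.
rewrite mulrC mulrAC -mulrA; apply: ler_wpM2l => //.
by rewrite ler_pdivlMr ?ltr0n // -natrM ler_nat leq_divM.
Unshelve. all: end_near.
Qed.

Lemma limn_esup_rate : limn_esup (fun n => (a n / n%:R)%:E) = rate%:E.
Proof.
have cv : (a n / n%:R)%:E @[n --> \oo] --> rate%:E.
  by apply: cvg_EFin; [near=> n | exact: fekete].
rewrite is_cvg_limn_esupE; first exact: cvg_lim cv.
by apply/cvg_ex; exists rate%:E.
Unshelve. all: end_near.
Qed.

End Fekete.

(** * Additivity along a central extension *)

Section SectionEntropy.
Variables (R : realType) (G : groupType) (phi : {multiplicative G -> G}).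
Implicit Types (A B E F S : {fset G}) (K L M : set G) (x y z : G).
Local Notation invariant_normal := (invariant_normal phi).
Local Open Scope ring_scope.

Definition log_growth L F n : R := ln (growth phi L F n)%:R.

Lemma log_growth_ge0 L F n : 0 <= log_growth L F n.
Proof.
rewrite /log_growth; case: (growth _ _ _ _) => [|m]; first by rewrite ln0.
by apply: ln_ge0; rewrite ler1n.
Qed.

Lemma ln_nat_le n m : (0 < n)%N -> (n <= m)%N -> ln n%:R <= ln m%:R :> R.
Proof.
move=> n0 nm; rewrite ler_ln ?ler_nat // posrE ltr0n //.
exact: leq_trans nm.
Qed.

Lemma ln_natM n m : (0 < n)%N -> (0 < m)%N ->
  ln (n * m)%:R = ln n%:R + ln m%:R :> R.
Proof. by move=> n0 m0; rewrite natrM lnM // posrE ltr0n. Qed.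

Lemma log_growthD L F n m : invariant_normal L -> F != fset0 ->
  log_growth L F (n + m) <= log_growth L F n + log_growth L F m.
Proof.
move=> nL F0; rewrite -ln_natM ?growth_gt0 //.
by apply: ln_nat_le; [exact: growth_gt0 | exact: growthD].
Qed.

(** The entropy of the endomorphism induced on [K / L], with the limsup of the
    definition of entropy already turned into an infimum. *)
Definition sec_entropy K L : \bar R :=
  ereal_sup [set (rate (log_growth L F))%:E |
    F in [set F | F != fset0 /\ forall x, x \in F -> K x]].

Lemma sec_entropy_ge K L F : F != fset0 -> (forall x, x \in F -> K x) ->
  ((rate (log_growth L F))%:E <= sec_entropy K L)%E.
Proof. by move=> F0 FK; apply: ereal_sup_ubound; exists F. Qed.

Lemma sec_entropy_le K L (h : \bar R) :
  (forall F, F != fset0 -> (forall x, x \in F -> K x) ->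
     ((rate (log_growth L F))%:E <= h)%E) ->
  (sec_entropy K L <= h)%E.
Proof. by move=> Fh; apply: ge_ereal_sup => _ [F [F0 FK] <-]; exact: Fh. Qed.

Section CentralExtension.
Variables K L M : set G.
Hypotheses (nL : invariant_normal L) (nM : invariant_normal M).
Hypotheses (LM : L `<=` M) (MK : M `<=` K).
Hypothesis KM : forall x y, K x -> K y -> K (x * y)%g.
Hypothesis cMG : forall x y, M x -> L [~ x, y]%g.

(** [growth_le] at time [m k], where [m] nearly realizes the rate of [E]; the
    time [m k] is as good as [m] by subadditivity. *)
Lemma rate_central_le F k : (0 < k)%N -> F != fset0 -> exists E,
  [/\ E != fset0, forall x, x \in E -> M x &
      rate (log_growth L F) <= log_growth M F k / k%:R + rate (log_growth L E)].
Proof.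
move=> k0 F0; have [E [E0 EM FE]] := growth_le nL nM cMG k0 F0.
exists E; split=> //; apply/ler_addgt0Pr => e e0.
have [m m0 Em] := rate_adherent (log_growth_ge0 L E) e0.
have mk0 : (0 < m * k)%N by rewrite muln_gt0 m0.
apply: le_trans (rate_le (log_growth_ge0 L F) mk0) _.
rewrite -addrA; apply: (@le_trans _ _
    (log_growth M F k / k%:R + log_growth L E m / m%:R)); last first.
  by rewrite lerD2l ltW.
have kR : 0 < k%:R :> R by rewrite ltr0n.
have mR : 0 < m%:R :> R by rewrite ltr0n.
have FEm : log_growth L F (m * k) <=
    m%:R * log_growth M F k + k%:R * log_growth L E m.
  have := ln_nat_le (growth_gt0 _ _ _ F0) (FE m).
  rewrite ln_natM ?expn_gt0 ?growth_gt0 // natrX lnXn ?ltr0n ?growth_gt0 //.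
  rewrite mulr_natl => /le_trans; apply; rewrite lerD2l mulnC.
  by apply: subadditive_mul => // n n'; exact: log_growthD.
apply: (@le_trans _ _
    ((m%:R * log_growth M F k + k%:R * log_growth L E m) / (m * k)%:R)).
  by rewrite ler_pM2r // invr_gt0 ltr0n.
by rewrite natrM le_eqVlt; apply/orP; left; apply/eqP; field; rewrite !gt_eqF.
Qed.

Lemma rate_central_ge E F : E != fset0 -> F != fset0 ->
  (forall x, x \in E -> M x) ->
  rate (log_growth L E) + rate (log_growth M F) <=
    rate (log_growth L (fset_mulg E F)).
Proof.
move=> E0 F0 EM; apply: rate_ge => [|n n0]; first exact: log_growth_ge0.
apply: (@le_trans _ _ (log_growth L E n / n%:R + log_growth M F n / n%:R)).
  by apply: lerD; apply: rate_le => // m; exact: log_growth_ge0.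
rewrite -mulrDl ler_pM2r ?invr_gt0 ?ltr0n // -ln_natM ?growth_gt0 //.
by apply: ln_nat_le; [rewrite muln_gt0 !growth_gt0 | exact: growth_ge].
Qed.

Local Open Scope ereal_scope.

Lemma sec_entropy_ge0 K' L' : K' 1%g -> 0 <= sec_entropy K' L'.
Proof.
move=> K1.
apply: (@le_trans _ _ (rate (log_growth L' [fset 1%g]%fset))%:E); last first.
  by apply: (sec_entropy_ge _ (fset1g_neq0 G)) => x /fset1P ->.
by rewrite lee_fin rate_ge // => n; rewrite ?divr_ge0 ?log_growth_ge0.
Qed.

(** For the upper bound, [k] is free while the subset [E] of [M] depends on
    it, so the rate of [E] is first replaced by the entropy of [M / L]. *)
Lemma sec_entropyD : sec_entropy K L = sec_entropy K M + sec_entropy M L.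
Proof.
have M1 : M 1%g := inv_normal1 nM.
have ML0 := sec_entropy_ge0 L M1.
apply/eqP; rewrite eq_le; apply/andP; split.
  apply: sec_entropy_le => F F0 FK.
  apply: (@le_trans _ _ ((rate (log_growth M F))%:E + sec_entropy M L));
      last first.
    by apply: leeD2r; exact: sec_entropy_ge.
  case: (sec_entropy M L) ML0 (@sec_entropy_ge M L) => [h _ ubh|_ _|//].
    rewrite -EFinD lee_fin -lerBlDr; apply: rate_ge => [|k k0].
      exact: log_growth_ge0.
    have [E [E0 EM FE]] := rate_central_le k0 F0.
    rewrite lerBlDr; apply: le_trans FE _; rewrite lerD2l.
    by have := ubh _ E0 EM; rewrite lee_fin.
  by rewrite addey ?leey.
have EF_le E F : E != fset0 -> F != fset0 -> (forall x, x \in E -> M x) ->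
    (forall x, x \in F -> K x) ->
    (rate (log_growth L E))%:E + (rate (log_growth M F))%:E <= sec_entropy K L.
  move=> E0 F0 EM FK; rewrite -EFinD.
  apply: (@le_trans _ _ (rate (log_growth L (fset_mulg E F)))%:E).
    by rewrite lee_fin rate_central_ge.
  apply: sec_entropy_ge.
    case/fset0Pn: E0 => e eE; case/fset0Pn: F0 => f fF.
    by apply/fset0Pn; exists (e * f)%g; apply/mem_mulg; exists e, f.
  by move=> _ /mem_mulg[e [f [/EM/MK Ke /FK Kf ->]]]; exact: KM.
have ML_le F : F != fset0 -> (forall x, x \in F -> K x) ->
    (rate (log_growth M F))%:E + sec_entropy M L <= sec_entropy K L.
  move=> F0 FK; rewrite addeC -leeBrDr //; apply: sec_entropy_le => E E0 EM.
  by rewrite leeBrDr //; exact: EF_le.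
case: (sec_entropy M L) ML0 ML_le => [h _ hub|_ yub|//].
  rewrite -leeBrDr //; apply: sec_entropy_le => F F0 FK.
  by rewrite leeBrDr //; exact: hub.
have := yub _ (fset1g_neq0 G); rewrite addey // leye_eq.
move=> /(_ _)/eqP -> //; first by rewrite leey.
by move=> x /fset1P ->; exact: MK.
Qed.

End CentralExtension.
End SectionEntropy.

(** * Reduction of the nilpotent case to central extensions *)

Section LowerSeries.
Variables (G : groupType) (phi : {multiplicative G -> G}).
Implicit Types (L M N : set G) (x y z : G).
Local Notation invariant_normal := (invariant_normal phi).

(** The subgroup [[N, G]]. *)
Inductive comm_subgroup N : set G :=
| comm_subgroup_comm x y of N x : comm_subgroup N [~ x, y]
| comm_subgroup1 : comm_subgroup N 1
| comm_subgroupM x y of comm_subgroup N x & comm_subgroup N y :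
    comm_subgroup N (x * y)
| comm_subgroupV x of comm_subgroup N x : comm_subgroup N x^-1.

Lemma comm_subgroup_normal N :
  invariant_normal N -> invariant_normal (comm_subgroup N).
Proof.
move=> nN; split; [exact: comm_subgroup1|exact: comm_subgroupM|
  exact: comm_subgroupV| |].
  move=> x z; elim=> [{}x y Nx||{}x y _ IHx _ IHy|{}x _ IHx].
  - by rewrite conjRg; apply: comm_subgroup_comm; exact: (inv_normalJ nN).
  - by rewrite conj1g; exact: comm_subgroup1.
  - by rewrite conjMg; exact: comm_subgroupM.
  - by rewrite conjVg; exact: comm_subgroupV.
have phiV x : phi x^-1 = (phi x)^-1.
  by apply: (mulgI (phi x)); rewrite -gmulfM !mulgV mult1.
move=> x; elim=> [{}x y Nx||{}x y _ IHx _ IHy|{}x _ IHx].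
- rewrite commgEl /conjg !gmulfM !phiV -/(conjg _ _) -commgEl.
  by apply: comm_subgroup_comm; exact: (inv_normal_phi nN).
- by rewrite mult1; exact: comm_subgroup1.
- by rewrite gmulfM; exact: comm_subgroupM.
- by rewrite phiV; exact: comm_subgroupV.
Qed.

Lemma comm_subgroup_sub N : invariant_normal N -> comm_subgroup N `<=` N.
Proof.
move=> nN x; elim=> [{}x y Nx||{}x y _ IHx _ IHy|{}x _ IHx].
- rewrite commgEl; apply: (inv_normalM nN); last exact: (inv_normalJ nN).
  exact: (inv_normalV nN).
- exact: (inv_normal1 nN).
- exact: (inv_normalM nN).
- exact: (inv_normalV nN).
Qed.

(** The iterated commutator subgroup [[N, G, ..., G]]. *)
Fixpoint relative_lower_central N n : set G :=
  if n is m.+1 then comm_subgroup (relative_lower_central N m) else N.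

Lemma relative_lower_central_normal N n :
  invariant_normal N -> invariant_normal (relative_lower_central N n).
Proof. by move=> nN; elim: n => //= n; exact: comm_subgroup_normal. Qed.

Lemma relative_lower_central_sub N n :
  invariant_normal N -> relative_lower_central N n `<=` N.
Proof.
move=> nN; elim: n => //= n; apply: subset_trans; apply: comm_subgroup_sub.
exact: relative_lower_central_normal.
Qed.

Lemma upper_central1 n : upper_central n (1 : G).
Proof. by elim: n => //= n IH y; rewrite commgEl conj1g invg1 mulg1. Qed.

Lemma upper_centralJ n x z : upper_central n x -> upper_central n (x ^ z).
Proof.
elim: n x z => [x z /= ->|n IH x z Zx y] /=; first by rewrite conj1g.
by rewrite -(conjgKV z y) -conjRg; exact/IH/Zx.
Qed.

Lemma upper_centralM n x y :
  upper_central n x -> upper_central n y -> upper_central n (x * y).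
Proof.
elim: n x y => [x y /= -> ->|n IH x y Zx Zy z] /=; first by rewrite mulg1.
have -> : [~ x * y, z] = [~ x, z] ^ y * [~ y, z].
  by rewrite !commgEl conjMg !conjgE !invgM -!mulgA !(mulKg, mulVKg).
by apply: IH; [exact/upper_centralJ/Zx | exact: Zy].
Qed.

Lemma upper_centralV n x : upper_central n x -> upper_central n x^-1.
Proof.
elim: n x => [x /= ->|n IH x Zx z] /=; first by rewrite invg1.
have -> : [~ x^-1, z] = ([~ x, z] ^ x^-1)^-1.
  by rewrite !commgEl !conjgE !invgM !invgK -!mulgA mulgV mulg1.
by apply/IH/upper_centralJ/Zx.
Qed.

(** The usual comparison of the lower and upper central series: each commutator
    with [G] goes down by at least one step of the upper central series. *)
Lemma relative_lower_central_upper N n m :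
  upper_central (m + n) = [set: G] ->
  relative_lower_central N n `<=` upper_central m.
Proof.
elim: n m => [|n IH] m; first by rewrite addn0 => ->.
rewrite addnS -addSn => /IH Nn x /=.
elim=> [{}x y /Nn|||]; first exact.
- exact: upper_central1.
- by move=> {}x y _ Zx _ Zy; exact: upper_centralM.
- by move=> {}x _; exact: upper_centralV.
Qed.

Lemma nilpotent_relative_lower_central N :
  nilpotent_group G -> invariant_normal N ->
  exists c, relative_lower_central N c = [set 1].
Proof.
case=> c Zc nN; exists c; apply/seteqP; split.
  exact: (@relative_lower_central_upper N c 0).
by move=> _ ->; exact: inv_normal1 (relative_lower_central_normal c nN).
Qed.

Variable R : realType.
Local Open Scope ereal_scope.

Lemma sec_entropy_self N : invariant_normal N -> sec_entropy R phi N N = 0.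
Proof.
move=> nN; apply/eqP; rewrite eq_le sec_entropy_ge0 ?andbT; last first.
  exact: inv_normal1 nN.
apply: sec_entropy_le => F F0 FN; rewrite lee_fin.
apply: le_trans (rate_le (log_growth_ge0 R phi N F) (ltn0Sn 0)) _.
rewrite divr1 /log_growth (_ : growth phi N F 1 = 1%N) ?ln1 //.
apply/eqP; rewrite eqn_leq growth_gt0 // andbT -(cardfs1 (1%g : G)).
apply: leq_trans (ncosets_le_card N _); apply: ncosets_le => x xT.
exists 1%g; rewrite ?fset11 //; apply/(lcosetP _ _ nN).
rewrite mulg1; apply: (inv_normalV nN).
exact: mem_trajectory_normal xT.
Qed.

(** The induction is on the length [c] of the series [[N, G, ..., G]] and not
    on the nilpotency class; the trivial group is its last term. *)
Lemma sec_entropy_nilpotent N : nilpotent_group G -> invariant_normal N ->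
  sec_entropy R phi setT [set 1%g] =
  sec_entropy R phi N [set 1%g] + sec_entropy R phi setT N.
Proof.
move=> nilG nN.
have [c <-] := nilpotent_relative_lower_central nilG nN; rewrite addeC.
elim: c => [|n IH]; first by rewrite /= sec_entropy_self // adde0.
pose L := relative_lower_central N n.+1; pose M := relative_lower_central N n.
have nL : invariant_normal L := relative_lower_central_normal n.+1 nN.
have nM : invariant_normal M := relative_lower_central_normal n nN.
have LM : L `<=` M := comm_subgroup_sub nM.
have cM x y : M x -> L [~ x, y]%g by move=> Mx; exact: comm_subgroup_comm.
rewrite (sec_entropyD _ nL nM LM (@subsetT _ M) (fun _ _ _ _ => I) cM) IH.
rewrite (sec_entropyD _ nL nM LM (relative_lower_central_sub nN)
  (inv_normalM nN) cM).
by rewrite addeA.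
Qed.

End LowerSeries.

(** * The three entropies as entropies of sections *)

Section Transfer.
Variable R : realType.

Lemma imfset_trajectory (A B : groupType) (alpha : {multiplicative A -> A})
    (beta : {multiplicative B -> B}) (f : A -> B) (F : {fset A}) n :
  f 1 = 1 -> {morph f : x y / x * y} -> (forall x, f (alpha x) = beta (f x)) ->
  trajectory beta [fset f x | x in F]%fset n =
  [fset f x | x in trajectory alpha F n]%fset.
Proof.
move=> f1 fM fphi; have f_iter i x : f (iter i alpha x) = iter i beta (f x).
  by elim: i => //= i <-.
elim: n => [|n IH].
  apply/fsetP => y; rewrite !trajectory0; apply/fset1P/imfsetP.
    by move=> ->; exists 1; rewrite ?fset11.
  by case=> x /fset1P -> ->.
apply/fsetP => y; apply/mem_trajectoryS/imfsetP.
  rewrite IH => -[_ [_ [/imfsetP[x xT ->] /imfsetP[z zF ->] ->]]].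
  exists (x * iter n alpha z); last by rewrite fM f_iter.
  by apply/mem_trajectoryS; exists x, z.
case=> t /mem_trajectoryS[x [z [xT zF ->]]] ->; exists (f x), (f z).
by rewrite IH fM f_iter; split=> //; exact: in_imfset.
Qed.

Lemma ncosets1 (G : groupType) (A : {fset G}) : ncosets [set 1] A = #|` A|.
Proof.
apply: card_imfset => x y /= e.
have : lcoset [set 1] x x by rewrite /lcoset /= mulVg.
by rewrite e => /= yx; rewrite -[LHS](mulVKg y) yx mulg1.
Qed.

(** The entropy of an endomorphism [psi] of [A] is that of the section [K / L]
    as soon as finite subsets of [A] and of [K] can be matched with the same
    growth. The three entropies of the theorem are instances. *)
Lemma algebraic_entropyE (G A : groupType) (phi : {multiplicative G -> G})
    (psi : {multiplicative A -> A}) (K L : set G) :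
  invariant_normal phi L ->
  (forall F' : {fset A}, F' != fset0 -> exists F : {fset G},
    [/\ F != fset0, forall x, x \in F -> K x &
        forall n, #|` trajectory psi F' n| = growth phi L F n]) ->
  (forall F : {fset G}, F != fset0 -> (forall x, x \in F -> K x) ->
    exists2 F' : {fset A}, F' != fset0 &
        forall n, #|` trajectory psi F' n| = growth phi L F n) ->
  algebraic_entropy R psi = sec_entropy R phi K L.
Proof.
move=> nL AG GA.
have entropy_atE F F' : F != fset0 ->
    (forall n, #|` trajectory psi F' n| = growth phi L F n) ->
    entropy_at R psi F' = (rate (log_growth R phi L F))%:E.
  move=> F0 e; rewrite -limn_esup_rate; first last.
  - by move=> n m; exact: log_growthD.
  - exact: log_growth_ge0.
  by rewrite /entropy_at; congr limn_esup; apply/funext => n; rewrite e.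
congr ereal_sup; apply/seteqP; split=> t [F /=].
  by move=> /AG[F' [F'0 F'K e]] <-; exists F' => //; rewrite (entropy_atE F').
move=> [F0 FK] <-; have [F' F'0 e] := GA F F0 FK.
by exists F' => //; exact: entropy_atE.
Qed.

Section Endomorphism.
Variables (G : groupType) (phi : {multiplicative G -> G}).

Lemma invariant_normal1 : invariant_normal phi [set 1].
Proof.
split=> //= [x y -> ->|x ->|x y ->|x ->]; first by rewrite mulg1.
- by rewrite invg1.
- by rewrite conj1g.
- by rewrite mult1.
Qed.

Lemma algebraic_entropy_full :
  algebraic_entropy R phi = sec_entropy R phi setT [set 1].
Proof.
apply: algebraic_entropyE => [|F F0|F F0 _]; first exact: invariant_normal1.
  by exists F; split=> // n; rewrite /growth ncosets1.
by exists F => // n; rewrite /growth ncosets1.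
Qed.

Variable H : normalClosed G.
Hypothesis phiH : {homo phi : x / x \in H}.

Lemma invariant_normal_pred : invariant_normal phi [set x | x \in H].
Proof.
split=> /=; [exact: gpred1|exact: gpredM| | |exact: phiH].
  by move=> x; rewrite gpredV.
by move=> x y; exact: gpredJr.
Qed.

Lemma algebraic_entropy_restr : algebraic_entropy R (restr_endo phiH) =
  sec_entropy R phi [set x | x \in H] [set 1].
Proof.
have cardT (F : {fset subgroup H}) n : #|` trajectory (restr_endo phiH) F n| =
    growth phi [set 1] [fset val x | x in F]%fset n.
  rewrite /growth ncosets1 (imfset_trajectory (alpha := restr_endo phiH)) //.
  by rewrite card_imfset //; exact: val_inj.
apply: algebraic_entropyE => [|F F0|F F0 FH]; first exact: invariant_normal1.
  exists [fset val x | x in F]%fset; split=> //.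
    case/fset0Pn: F0 => x xF; apply/fset0Pn; exists (val x).
    exact: in_imfset.
  by move=> _ /imfsetP[x _ ->]; exact: valP.
have eF : F =
    [fset val x | x in [fset (insubd 1 x : subgroup H) | x in F]]%fset.
  apply/fsetP => x; apply/idP/imfsetP => [xF|].
    exists (insubd 1 x); first exact: in_imfset.
    by rewrite val_insubd (FH x xF).
  by case=> _ /imfsetP[y yF ->] ->; rewrite val_insubd (FH y yF).
exists [fset (insubd 1 x : subgroup H) | x in F]%fset => [|n]; last first.
  by rewrite cardT -eF.
by apply: contra_neq F0 => e; rewrite eF e imfset0.
Qed.

Lemma card_imfset_quotient (A : {fset G}) :
  #|` [fset \pi_(quotient_group H)%qT x | x in A]%fset| =
  ncosets [set x | x \in H] A.
Proof.
have nH := invariant_normal_pred.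
have piP x y : \pi_(quotient_group H)%qT x = \pi_(quotient_group H)%qT y <->
    lcoset [set x | x \in H] x = lcoset [set x | x \in H] y.
  by split=> [/coset_eqP/(lcosetP _ _ nH)|/(lcosetP _ _ nH)/coset_eqP].
pose f (a : quotient_group H) := lcoset [set x | x \in H] (repr a).
have fE x : f (\pi x)%qT = lcoset [set x | x \in H] x.
  by apply/piP; rewrite reprK.
have finj : injective f.
  by elim/quotient_groupW=> x; elim/quotient_groupW=> y; rewrite !fE => /piP.
set B := [fset _ | _ in _]%fset.
have <- : #|` [fset f a | a in B]%fset| = #|` B| by exact: card_imfset.
rewrite /ncosets; congr #|` _|.
apply/fsetP => c; apply/imfsetP/imfsetP => /= [[_ /imfsetP[x xA ->] ->]|].
  by exists x => //; rewrite fE.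
case=> x xA ->; exists (\pi x)%qT; rewrite ?fE //; exact: in_imfset.
Qed.

Lemma algebraic_entropy_quot : algebraic_entropy R (quot_endo phiH) =
  sec_entropy R phi setT [set x | x \in H].
Proof.
have cardT (F : {fset G}) n :
    #|` trajectory (quot_endo phiH)
          [fset \pi_(quotient_group H)%qT x | x in F]%fset n| =
    growth phi [set x | x \in H] F n.
  rewrite (imfset_trajectory (alpha := phi)) ?card_imfset_quotient //.
  - exact: quot_piM.
  - by move=> x; rewrite -quot_endoE.
apply: algebraic_entropyE => [|F F0|F F0 _]; first exact: invariant_normal_pred.
  exists [fset repr (a : quotient_group H) | a in F]%fset; split=> // [|n].
    case/fset0Pn: F0 => a aF; apply/fset0Pn; exists (repr a).
    exact: in_imfset.
  rewrite -cardT; congr #|` trajectory _ _ n|; apply/fsetP => a.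
  apply/idP/imfsetP => [aF|[_ /imfsetP[b bF ->] ->]]; last by rewrite reprK.
  by exists (repr a); rewrite ?reprK //; exact: in_imfset.
exists [fset \pi_(quotient_group H)%qT x | x in F]%fset => [|n]; last first.
  exact: cardT.
case/fset0Pn: F0 => x xF; apply/fset0Pn.
by exists (\pi x)%qT; exact: in_imfset.
Qed.

End Endomorphism.
End Transfer.

Theorem theorem4p6 (R : realType) (G : groupType)
    (phi : {multiplicative G -> G}) (H : normalClosed G)
    (nilG : nilpotent_group G) (phiH : {homo phi : x / x \in H}) :
  (algebraic_entropy R phi =
     algebraic_entropy R (restr_endo phiH) +
     algebraic_entropy R (quot_endo phiH))%E.
Proof.
rewrite algebraic_entropy_full algebraic_entropy_restr algebraic_entropy_quot.
exact: sec_entropy_nilpotent nilG (invariant_normal_pred phiH).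
Qed.
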